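(* Define the set of ''tight'' conductance configurations by $$\Omega':=\Bigl\{\omega\in\Omega\colon\lim_{\epsilon\downarrow0}\limsup_{n\to\infty}\frac1{n^d}\sum_{e\in E(\Lambda_n)}1_{\mathbb R\smallsetminus[\epsilon,1/\epsilon]}(c_\omega(e))=0\Bigr\}.$$ Then for each averaging $\omega\in\Omega'$, the limit $$\ell_\omega(f):=\lim_{n\to\infty}\frac1{|\Lambda_n|}\sum_{x\in\Lambda_n}f\circ\tau_x(\omega)$$ exists for all $f\in C_b(\Omega)$ and there exists a unique probability measure $\mathbb P_\omega$ on $(\Omega,\mathcal F)$ such that $$\forall f\in C_b(\Omega)\colon\quad E_{\mathbb P_\omega}(f)=\ell_\omega(f).$$ Moreover, $\mathbb P_\omega$ is translation invariant, i.e., $\mathbb P_\omega\circ\tau_x^{-1}=\mathbb P_\omega$ for all $x\in\mathbb Z^d$.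
   Context: Let $d\ge1$ be an integer and let $E(\mathbb Z^d)$ be the set of ordered nearest-neighbor pairs (edges) of $\mathbb Z^d$. Let $\Omega$ be the set of $\omega\in(0,\infty)^{E(\mathbb Z^d)}$ with $c_\omega(x,y)=c_\omega(y,x)$ for all $(x,y)\in E(\mathbb Z^d)$, where $c_\omega(e)$ denotes the coordinate of $\omega$ at $e$. $\Omega$ carries the product Euclidean topology and the product $\sigma$-algebra $\mathcal F$. For $x\in\mathbb Z^d$ the shift $\tau_x\colon\Omega\to\Omega$ is $\tau_x(\omega)(y,z)=\omega(y+x,z+x)$. For $r\ge0$, $\Lambda_r:=[-r,r]^d\cap\mathbb Z^d$; for $\Lambda\subseteq\mathbb Z^d$, $E(\Lambda)$ is the set of edges incident with at least one vertex of $\Lambda$. $C(\Omega)$ is the set of continuous functions $\Omega\to\mathbb R$ and $C_b(\Omega)$ the subset of bounded ones. $C_{\mathrm{loc}}(\Omega)$ is the set of $f\in C(\Omega)$ for which there is a finite $B\subseteq E(\mathbb Z^d)$ such that $f$ depends only on $\omega$ restricted to $B$ and, regarded as a function on $(0,\infty)^B$, has compact support. A configuration $\omega\in\Omega$ is averaging if $\lim_{n\to\infty}\frac1{|\Lambda_n|}\sum_{x\in\Lambda_n}f\circ\tau_x(\omega)$ exists for each $f\in C_{\mathrm{loc}}(\Omega)$. *)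

(* Defs.v *)
From HB Require Import structures.
From mathcomp Require Import all_boot all_order all_algebra finmap.
From mathcomp Require Import all_classical all_reals all_analysis.
Import Order.TTheory GRing.Theory Num.Theory.
Import numFieldNormedType.Exports.

Set Implicit Arguments.
Unset Strict Implicit.
Unset Printing Implicit Defensive.

Local Open Scope classical_set_scope.
Local Open Scope ring_scope.

Section Lattice.
Variable d : nat.

Definition adjacent (x y : 'rV[int]_d) : bool :=
  \sum_(i < d) `|x 0 i - y 0 i| == 1.

Lemma adjacentC x y : adjacent x y = adjacent y x.
Proof.
by congr (_ == _); apply: eq_bigr => i _; rewrite distrC.
Qed.

Lemma adjacentD x y z : adjacent (y + x) (z + x) = adjacent y z.
Proof.
congr (_ == _); apply: eq_bigr => i _.
by rewrite !mxE opprD addrACA subrr addr0.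
Qed.

Definition edge : Type :=
  {e : 'rV[int]_d * 'rV[int]_d | adjacent e.1 e.2}.
HB.instance Definition _ := Countable.on edge.

Definition edge_rev (e : edge) : edge :=
  exist (fun p => adjacent p.1 p.2) ((val e).2, (val e).1)
    (etrans (adjacentC _ _) (valP e)).

Definition edge_shift (x : 'rV[int]_d) (e : edge) : edge :=
  exist (fun p => adjacent p.1 p.2) ((val e).1 + x, (val e).2 + x)
    (etrans (adjacentD _ _ _) (valP e)).

Definition Lambda (n : nat) : set 'rV[int]_d :=
  [set x | forall i, `|x 0 i| <= n%:Z].

Definition incident_edges (L : set 'rV[int]_d) : set edge :=
  [set e | L (val e).1 \/ L (val e).2].

End Lattice.

Arguments Lambda : clear implicits.

Definition posreal (R : realType) : Type := set_type [set x : R | 0 < x].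
HB.instance Definition _ (R : realType) :=
  Topological.copy (posreal R) (set_type [set x : R | 0 < x]).

Section Configurations.
Variables (R : realType) (d : nat).

Definition symmetric_conductances : set {ptws edge d -> posreal R} :=
  [set w | forall e, w e = w (edge_rev e)].

Definition Omega : Type := set_type symmetric_conductances.
HB.instance Definition _ :=
  Topological.copy Omega (set_type symmetric_conductances).

Definition conductance (w : Omega) (e : edge d) : R := val (val w e).

Definition posreal1 : posreal R := exist _ (1 : R) (mem_set (@ltr01 R)).

Lemma constant1_subproof : (fun=> posreal1) \in symmetric_conductances.
Proof. exact: mem_set. Qed.

Definition constant1 : Omega :=
  exist (fun w => w \in symmetric_conductances) _ constant1_subproof.
HB.instance Definition _ := isPointed.Build Omega constant1.

Definition coordinate_events : set (set Omega) :=
  \bigcup_e preimage_set_system setT (conductance ^~ e) measurable.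
HB.instance Definition _ :=
  Measurable.copy Omega (g_sigma_algebraType coordinate_events).

Lemma tau_subproof (x : 'rV[int]_d) (w : Omega) :
  (fun e => val w (edge_shift x e)) \in symmetric_conductances.
Proof.
apply: mem_set => e /=; rewrite (set_mem (valP w)).
by congr (val w _); apply: val_inj.
Qed.

Definition tau (x : 'rV[int]_d) (w : Omega) : Omega :=
  exist (fun v => v \in symmetric_conductances) _ (tau_subproof x w).

Definition Cb : set (Omega -> R) :=
  [set f | continuous f /\ bounded_fun f].

Definition restriction (B : set (edge d)) (w : Omega) :
    {ptws set_type B -> posreal R} :=
  fun e => val w (val e).
Arguments restriction : clear implicits.

(* The finite set B may contain an edge together with its reversal; the values
   of g off the image of [restriction B] are then arbitrary, which does not
   enlarge the class since B can be reduced to one orientation of each edge. *)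
Definition Cloc : set (Omega -> R) :=
  [set f | continuous f /\
    exists (B : set (edge d)) (g : {ptws set_type B -> posreal R} -> R),
      [/\ finite_set B,
          forall w, f w = g (restriction B w) &
          compact (closure [set u | g u != 0])]].

Definition spatial_average (f : Omega -> R) (w : Omega) (n : nat) : R :=
  (\sum_(x \in Lambda d n) f (tau x w)) / #|` fset_set (Lambda d n)|%:R.

Definition averaging (w : Omega) : Prop :=
  forall f, Cloc f -> cvgn (spatial_average f w).

Definition outlier_density (w : Omega) (eps : R) (n : nat) : R :=
  (\sum_(e \in incident_edges (Lambda d n))
      (\1_(~` `[eps, eps^-1]%classic) (conductance w e) : R)) / n%:R ^+ d.

(* The limsup is taken in the extended reals, where it always exists; the term
   n = 0 (a division by zero) is irrelevant to it. *)
Definition tight : set Omega :=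
  [set w | limn_esup (fun n => (outlier_density w eps n)%:E)
           @[eps --> (0 : R)^'+] --> 0%E].

Definition ell (w : Omega) (f : Omega -> R) : R :=
  limn (spatial_average f w).

(* A [probability] is a function on all subsets, unspecified on the
   non-measurable ones, so equality of laws is tested on events only. *)
Definition same_law (P Q : set Omega -> \bar R) : Prop :=
  forall A : set Omega, measurable A -> P A = Q A.

End Configurations.

Arguments restriction {R d} B w.

(* Main.v *)
Require Import Defs.
From HB Require Import structures.
From mathcomp Require Import all_boot all_order all_algebra finmap.
From mathcomp Require Import all_classical all_reals all_analysis.
From mathcomp Require Import measurable_realfun zify lra.
Import Order.TTheory GRing.Theory Num.Theory.
Import numFieldNormedType.Exports.

(** Idea. Let [mu_n] be the empirical measure of the shifts of [w] by the points
of [Lambda_n]. Comparing single-edge averages over [Lambda_n] with the outlier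
density on [Lambda_(n + r)] turns tightness of [w] into uniform tightness of
the sequence [mu_n]. For every free ultrafilter [U] on the integers,
[m A := lim_U mu_n A] is a finitely additive probability on ALL subsets of
[Omega], with compact sets of almost full mass. Its compact inner
approximation on open sets, followed by the infimum over open supersets, is an
outer measure for which open sets are Caratheodory measurable; the resulting
probability [P_U] satisfies [m F <= P_U F] for closed [F], and a staircase
approximation gives [E f = lim_U mu_n f] for all bounded continuous [f].
Piecewise linear bumps supported in boxes are in [Cloc], so their [P_U]-means
do not depend on [U] because [w] is averaging; they determine the law, hence
all the [P_U] coincide and [mu_n f] converges. The averages of [f] and of
[f \o tau x] differ by a boundary term, whence translation invariance. *)

Set Implicit Arguments.
Unset Strict Implicit.
Unset Printing Implicit Defensive.

Local Open Scope classical_set_scope.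
Local Open Scope ring_scope.

(** * From finitely additive set functions to outer measures *)

Section finitely_additive_regularization.
Context {R : realType} {T : ptopologicalType} (m : set T -> R).
Hypotheses (hausdorffT : hausdorff_space T) (regularT : regular_space T).
Hypothesis m_ge0 : forall A, 0 <= m A.
Hypothesis m_additive : forall A B, A `&` B = set0 -> m (A `|` B) = m A + m B.
Hypothesis m_setT : m setT = 1.
Hypothesis m_tight : forall e, 0 < e -> exists2 K, compact K & m (~` K) <= e.

Lemma additive_set0 : m set0 = 0.
Proof.
apply: (addrI (m set0)).
by rewrite -m_additive ?setI0// setU0 addr0.
Qed.

Lemma additive_mono (A B : set T) : A `<=` B -> m A <= m B.
Proof.
move=> AB; rewrite -(setDUK AB) m_additive ?lerDl//.
by rewrite setDE setICA setICr setI0.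
Qed.

Lemma additive_subadditive (A B : set T) : m (A `|` B) <= m A + m B.
Proof.
rewrite -(setDUK (@subsetUl _ A B)) m_additive; last first.
  by rewrite setDE setICA setICr setI0.
by rewrite lerD2l additive_mono// => x [[]].
Qed.

Lemma additive_bigsetU (F : (set T)^nat) n :
  m (\big[setU/set0]_(i < n) F i) <= \sum_(i < n) m (F i).
Proof.
elim: n => [|n ih]; first by rewrite !big_ord0 additive_set0.
rewrite !big_ord_recr/= (le_trans (additive_subadditive _ _))//.
by rewrite lerD2r.
Qed.

Local Open Scope ereal_scope.

Definition inner_content (G : set T) : \bar R :=
  ereal_sup [set (m K)%:E | K in [set K | compact K /\ K `<=` G]].

Definition outer_content (A : set T) : \bar R :=
  ereal_inf [set inner_content G | G in [set G | open G /\ A `<=` G]].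

Lemma inner_content_ge (K G : set T) :
  compact K -> K `<=` G -> (m K)%:E <= inner_content G.
Proof. by move=> cK KG; apply: ereal_sup_ubound; exists K. Qed.

Lemma inner_content_le (G : set T) (x : \bar R) :
  (forall K, compact K -> K `<=` G -> (m K)%:E <= x) -> inner_content G <= x.
Proof. by move=> h; apply: ge_ereal_sup => _ [K [cK KG] <-]; exact: h. Qed.

Lemma inner_content_ge0 G : 0 <= inner_content G.
Proof.
by have := inner_content_ge compact0 (@sub0set _ G); rewrite additive_set0.
Qed.

Lemma inner_content_le1 G : inner_content G <= 1.
Proof.
by apply: inner_content_le => K _ _; rewrite -m_setT lee_fin additive_mono.
Qed.

Lemma inner_content_fin_num G : inner_content G \is a fin_num.
Proof.
rewrite ge0_fin_numE ?inner_content_ge0//.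
by rewrite (le_lt_trans (inner_content_le1 _))// ltry.
Qed.

Lemma inner_content_mono (G H : set T) :
  G `<=` H -> inner_content G <= inner_content H.
Proof.
move=> GH; apply: inner_content_le => K cK KG.
by apply: inner_content_ge => //; exact: subset_trans GH.
Qed.

(* A compact subset of the union is covered by finitely many sets whose
   closures lie in single [G i], hence is a finite union of compact subsets of
   the [G i]. *)
Lemma inner_content_bigcup (G : (set T)^nat) : (forall i, open (G i)) ->
  inner_content (\bigcup_i G i) <= \sum_(0 <= i <oo) inner_content (G i).
Proof.
move=> oG; apply: inner_content_le => K cK KG.
pose D := [set j : set T * nat | open j.1 /\ closure j.1 `<=` G j.2].
have := cK; rewrite compact_cover => /(_ _ D fst)[].
- by move=> j [].
- move=> x Kx; have [i _ Gix] := KG x Kx.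
  have [U xU UG] : filter_from (nbhs x) closure (G i).
    by apply: regularT; exact: open_nbhs_nbhs.
  exists (U^°%classic, i); last exact: xU.
  split=> /=; first exact: open_interior.
  by apply: subset_trans UG; apply: closureS; exact: interior_subset.
move=> D' D'D KD'.
(* The finite subcover is grouped by the index of its target [G i], and [N] exceeds every index that
   occurs. *)
pose C i := \bigcup_(j in [set j | j \in D' /\ j.2 = i]) closure j.1.
pose N := (\max_(j <- D') j.2).+1.
have finj i : finite_set [set j | j \in D' /\ j.2 = i].
  by apply: (sub_finite_set (B := [set` D'])) => // j [].
have cC i : compact (K `&` C i).
  apply: compact_closedI => //; apply: closed_bigcup => // j _.
  exact: closed_closure.
have CG i : K `&` C i `<=` G i.
  by move=> x [_ [j [/D'D + <-] /=]]; rewrite inE => -[_]; exact.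
have KC : K = \big[setU/set0]_(i < N) (K `&` C i).
  rewrite -(bigcup_mkord N (fun i => K `&` C i)).
  apply/seteqP; split=> [x Kx|x [i _ []]//].
  have [j jD' jx] := KD' x Kx; exists j.2 => /=.
    by rewrite ltnS; apply: (@leq_bigmax_seq _ _ _ (fun j => j.2)).
  by split=> //; exists j => //; exact: subset_closure.
rewrite KC; apply: (@le_trans _ _ (\sum_(i < N) inner_content (G i))).
  rewrite (le_trans (y := \sum_(i < N) (m (K `&` C i))%:E))//.
    by rewrite sumEFin lee_fin (additive_bigsetU (fun i => K `&` C i)).
  by apply: lee_sum => i _; exact: inner_content_ge.
rewrite -(big_mkord xpredT (fun i => inner_content (G i))).
by apply: nneseries_lim_ge => i _ _; exact: inner_content_ge0.
Qed.

Lemma outer_content_le (A G : set T) :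
  open G -> A `<=` G -> outer_content A <= inner_content G.
Proof. by move=> oG AG; apply: ereal_inf_lbound; exists G. Qed.

Lemma outer_content_ge (A : set T) (x : \bar R) :
  (forall G, open G -> A `<=` G -> x <= inner_content G) ->
  x <= outer_content A.
Proof. by move=> h; apply: le_ereal_inf_tmp => _ [G [oG AG] <-]; exact: h. Qed.

Lemma outer_content_open (G : set T) :
  open G -> outer_content G = inner_content G.
Proof.
move=> oG; apply/eqP; rewrite eq_le outer_content_le//=.
by apply: outer_content_ge => H oH; exact: inner_content_mono.
Qed.

Lemma outer_content0 : outer_content set0 = 0.
Proof.
rewrite outer_content_open; last exact: open0.
apply/eqP; rewrite eq_le inner_content_ge0 andbT.
by apply: inner_content_le => K _; rewrite subset0 => ->; rewrite additive_set0.
Qed.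

Lemma outer_content_ge0 A : 0 <= outer_content A.
Proof. by apply: outer_content_ge => G _ _; exact: inner_content_ge0. Qed.

Lemma outer_content_mono : {homo outer_content : A B / A `<=` B >-> A <= B}.
Proof.
move=> A B AB; apply: outer_content_ge => G oG BG.
by apply: outer_content_le => //; exact: subset_trans BG.
Qed.

Lemma outer_content_fin_num A : outer_content A \is a fin_num.
Proof.
rewrite ge0_fin_numE ?outer_content_ge0//.
rewrite (le_lt_trans (outer_content_le openT (@subsetT _ A)))//.
by rewrite (le_lt_trans (inner_content_le1 _))// ltry.
Qed.

Lemma outer_content_adherent A (e : R) : (0 < e)%R ->
  exists G, [/\ open G, A `<=` G & inner_content G <= outer_content A + e%:E].
Proof.
move=> e0; have [_ [G [oG AG] <-] /ltW] :=
  lb_ereal_inf_adherent e0 (outer_content_fin_num A).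
by exists G.
Qed.

(** Enclosing each [F i] in an open set with excess at most [e / 2 ^ i.+1] reduces the claim to
    [inner_content_bigcup]. *)
Lemma outer_content_sigma_subadditive : sigma_subadditive outer_content.
Proof.
move=> F; apply/lee_addgt0Pr => e e0.
have e2 i : (0 < e / (2 ^ i.+1)%:R)%R by rewrite divr_gt0// ltr0n expn_gt0.
have [G GP] := choice (fun i => outer_content_adherent (F i) (e2 i)).
apply: (le_trans _ (epsilon_trick xpredT
  (fun n => outer_content_ge0 (F n)) (ltW e0))).
apply: (@le_trans _ _ (\sum_(0 <= i <oo) inner_content (G i))).
  have oG i : open (G i) by case: (GP i).
  apply: (le_trans _ (inner_content_bigcup oG)).
  apply: outer_content_le; first by apply: bigcup_open => i _; exact: oG.
  by apply: subset_bigcup => i _; case: (GP i).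
apply: lee_nneseries => i _; first by move=> _; exact: inner_content_ge0.
by case: (GP i).
Qed.

HB.instance Definition _ := @isOuterMeasure.Build R T outer_content
  outer_content0 outer_content_ge0 outer_content_mono
  outer_content_sigma_subadditive.

(** Let [H] be an open superset of [X]. A compact [K] nearly exhausts the part of [H] inside [G],
    then a compact [L] nearly exhausts [H] minus [K]. This difference is open, since compact sets
    are closed, and contains the part of [X] outside [G]; [K] and [L] are disjoint compact subsets
    of [H]. *)
Lemma outer_content_caratheodory (G : set T) :
  open G -> outer_content.-caratheodory G.
Proof.
move=> oG; apply: le_caratheodory_measurable => X.
apply: outer_content_ge => H oH XH.
apply/lee_addgt0Pr => e e0; have e2 : (0 < e / 2)%R by rewrite divr_gt0.
have oHG : open (H `&` G) by exact: openI.
have [_ [K [cK KHG] <-] mK] :=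
  ub_ereal_sup_adherent e2 (inner_content_fin_num (H `&` G)).
have oHK : open (H `&` ~` K).
  by apply: openI => //; apply: closed_openC; exact: compact_closed.
have [_ [L [cL LHK] <-] mL] :=
  ub_ereal_sup_adherent e2 (inner_content_fin_num (H `&` ~` K)).
have XG : outer_content (X `&` G) <= inner_content (H `&` G).
  by apply: outer_content_le => //; exact: setSI.
have XCG : outer_content (X `&` ~` G) <= inner_content (H `&` ~` K).
  apply: outer_content_le => // x [Xx nGx]; split; first exact: XH.
  by move=> /KHG[].
have KL : (m K + m L)%:E <= inner_content H.
  rewrite -m_additive.
    apply: inner_content_ge; first exact: compactU.
    by move=> x [/KHG[]|/LHK[]].
  by apply/seteqP; split=> // x [Kx /LHK[]].
rewrite -[_ <= _]/(outer_content (X `&` G) + outer_content (X `&` ~` G)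
  <= inner_content H + e%:E).
(* All the contents are finite, so the estimates become linear inequalities between reals. *)
move: XG XCG mK mL KL; rewrite -!/(inner_content _).
rewrite -(fineK (outer_content_fin_num (X `&` G))).
rewrite -(fineK (outer_content_fin_num (X `&` ~` G))).
rewrite -(fineK (inner_content_fin_num (H `&` G))).
rewrite -(fineK (inner_content_fin_num (H `&` ~` K))).
rewrite -(fineK (inner_content_fin_num H)).
rewrite -!EFinB -!EFinD !lee_fin !lte_fin; lra.
Qed.

(** Tightness enters here: cutting [F] down to a compact [K] costs at most [e] and leaves a compact
    subset of every open set that contains [F]. *)
Lemma outer_content_closed_ge (F : set T) :
  closed F -> (m F)%:E <= outer_content F.
Proof.
move=> cF; apply: outer_content_ge => G oG FG.
apply/lee_addgt0Pr => e e0; have [K cK mK] := m_tight e0.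
have FK : compact (K `&` F) by exact: compact_closedI.
apply: (@le_trans _ _ ((m (K `&` F))%:E + e%:E)); last first.
  by rewrite leeD2r//; apply: inner_content_ge => // x [_ /FG].
rewrite -EFinD lee_fin (le_trans _ (lerD (lexx _) mK))//.
rewrite (le_trans _ (additive_subadditive _ _))// additive_mono// => x Fx.
by have [Kx|] := pselect (K x); [left|right].
Qed.

Lemma outer_content_setT : outer_content setT = 1.
Proof.
apply/eqP; rewrite eq_le outer_content_open; last exact: openT.
rewrite inner_content_le1 -outer_content_open; last exact: openT.
by rewrite -m_setT outer_content_closed_ge//; exact: closedT.
Qed.

Lemma tight_content_outer_measure :
  exists mu : {outer_measure set T -> \bar R},
    [/\ forall G, open G -> mu.-caratheodory G, mu setT = 1 &
        forall F, closed F -> (m F)%:E <= mu F].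
Proof.
exists outer_content; split.
- exact: outer_content_caratheodory.
- exact: outer_content_setT.
- exact: outer_content_closed_ge.
Qed.

End finitely_additive_regularization.

(** * Topology and Borel sets of the configuration space *)

Lemma fmap_ultra {T U : Type} (f : T -> U) (F : set_system T) :
  UltraFilter F -> UltraFilter (f @ F).
Proof.
move=> FU; split=> [|G GP FG]; first exact: fmap_proper_filter.
apply/seteqP; split=> // A GA; rewrite /= /fmap/=.
have [//|FCA] := in_ultra_setVsetC (f @^-1` A) FU.
have /FG GCA : (f @ F) (~` A) by [].
by have [x []] := filter_ex (filterI GA GCA).
Qed.

Lemma cvg_initial {S : choiceType} {T : topologicalType} (f : S -> T)
    (F : set_system S) (s : S) :
  Filter F -> f @ F --> f s -> F --> (s : initial_topology f).
Proof.
move=> FF Ffs A [_ [[B oB <-] Bs sBA]].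
by apply: filterS sBA _; apply: Ffs; exact: open_nbhs_nbhs.
Qed.

(** Rational endpoints make the family of boxes countable, as [open_sigma_boxes] requires. *)
Definition box_datum (d : nat) : Type := (edge d * (rat * rat))%type.
Arguments box_datum : clear implicits.

Section configuration_topology.
Context {R : realType} {d : nat}.
Local Notation Omega := (Omega R d).
Local Notation edge := (edge d).
Local Notation coord e := (fun w : Omega => conductance w e).

Lemma posreal_gt0 (x : posreal R) : 0 < val x.
Proof. by have := set_mem (valP x). Qed.

Lemma posreal_val_continuous : continuous (val : posreal R -> R).
Proof. exact: (@initial_continuous (posreal R) R). Qed.

Lemma posreal_cvg (F : set_system (posreal R)) (x : posreal R) :
  Filter F -> val @ F --> val x -> F --> x.
Proof. exact: (@cvg_initial (posreal R) R). Qed.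

Lemma ptws_cvg {I : eqType} {T : topologicalType} (F : set_system (I -> T))
    (f : I -> T) :
  Filter F -> (forall i, @^~ i @ F --> f i) -> F --> (f : {ptws I -> T}).
Proof.
move=> FF Ff; apply/cvg_sup => i.
exact: (@cvg_initial (prod_topology (fun=> T)) T).
Qed.

Lemma conductance_gt0 (w : Omega) e : 0 < conductance w e.
Proof. exact: posreal_gt0. Qed.

Lemma conductance_rev (w : Omega) e :
  conductance w (edge_rev e) = conductance w e.
Proof. by rewrite /conductance -(set_mem (valP w)). Qed.

Lemma conductance_inj (v w : Omega) : conductance v =1 conductance w -> v = w.
Proof.
move=> vw; apply/val_inj/funext => e; apply/val_inj; exact: vw.
Qed.

Lemma conductance_continuous e : continuous (coord e).
Proof.
move=> w; pose K (_ : edge) := posreal R.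
apply: (@continuous_comp Omega (prod_topology K) _ val
  (fun u => val (proj e u))).
  exact: (@initial_continuous Omega (prod_topology K)).
apply: (@continuous_comp (prod_topology K) (posreal R)).
  exact: (@proj_continuous _ K).
exact: posreal_val_continuous.
Qed.

Lemma Omega_cvg (F : set_system Omega) (w : Omega) : Filter F ->
  (forall e, coord e @ F --> conductance w e) -> F --> w.
Proof.
move=> FF Fw; apply: (@cvg_initial Omega {ptws edge -> posreal R}).
by apply: ptws_cvg => e; apply: posreal_cvg; exact: Fw.
Qed.

Lemma Omega_hausdorff : hausdorff_space Omega.
Proof.
move=> v w vw; apply: conductance_inj => e; apply: (@Rhausdorff R) => A B Av Bw.
have [u [Au Bu]] := vw _ _ (conductance_continuous Av)
  (conductance_continuous Bw).
by exists (conductance u e).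
Qed.

Lemma conductance_surj (l : edge -> R) : (forall e, 0 < l e) ->
  (forall e, l e = l (edge_rev e)) -> exists w : Omega, conductance w = l.
Proof.
move=> l_gt0 l_rev; pose g e : posreal R := exist _ (l e) (mem_set (l_gt0 e)).
have g_sym : (g : {ptws edge -> posreal R}) \in @symmetric_conductances R d.
  by apply: mem_set => e; apply: val_inj; exact: l_rev.
by exists (exist _ (g : {ptws edge -> posreal R}) g_sym).
Qed.

(** Along an ultrafilter every coordinate converges within its compact interval. The limits are
    positive by the bound [lo] and inherit the symmetry, so they form a configuration. *)
Lemma compact_box (lo hi : edge -> R) : (forall e, 0 < lo e) ->
  compact [set w : Omega | forall e, lo e <= conductance w e <= hi e].
Proof.
move=> lo0; rewrite compact_ultra => F FU FA.
pose l e := lim (coord e @ F).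
have Fl e : lo e <= l e <= hi e /\ coord e @ F --> l e.
  have FeU : UltraFilter (coord e @ F) by exact: fmap_ultra.
  have := @segment_compact R (lo e) (hi e); rewrite compact_ultra.
  move=> /(_ _ FeU)[|x [xI Fx]].
    change (F (coord e @^-1` `[lo e, hi e])).
    by apply: filterS FA => w /(_ e); rewrite /= in_itv.
  by rewrite /l (cvg_lim _ Fx)//.
have l0 e : 0 < l e by have [/andP[+ _] _] := Fl e; exact: lt_le_trans.
have lrev e : l e = l (edge_rev e).
  rewrite /l; congr (lim (_ @ F)); apply/funext => w.
  by rewrite conductance_rev.
have [w wE] := conductance_surj l0 lrev.
exists w; split=> [e|]; first by rewrite wE; have [] := Fl e.
by apply: Omega_cvg => e; rewrite wE; have [] := Fl e.
Qed.

Definition open_box (s : seq (box_datum d)) : set Omega :=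
  [set w | forall p, p \in s ->
    ratr p.2.1 < conductance w p.1 < ratr p.2.2].

Definition closed_box (s : seq (box_datum d)) : set Omega :=
  [set w | forall p, p \in s ->
    ratr p.2.1 <= conductance w p.1 <= ratr p.2.2].

(** A positive lower endpoint keeps closed intervals compact inside the open half-line, which gives
    bumps their compact support. *)
Definition positive_box (s : seq (box_datum d)) : bool :=
  all (fun p => 0 < p.2.1) s.

Lemma open_box_cat s t : open_box (s ++ t) = open_box s `&` open_box t.
Proof.
apply/seteqP; split=> [w wst|w [ws wt] p].
  by split=> p ps; apply: wst; rewrite mem_cat ps ?orbT.
by rewrite mem_cat => /orP[/ws|/wt].
Qed.

Lemma open_box_nil : open_box [::] = setT.
Proof. by apply/seteqP; split. Qed.

Lemma open_box_cons p s : open_box (p :: s) =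
  coord p.1 @^-1` `]ratr p.2.1, ratr p.2.2[
    `&` open_box s.
Proof.
apply/seteqP; split=> [w wps|w [wp ws] q].
  split; first by rewrite /= in_itv/= wps// inE eqxx.
  by move=> q qs; apply: wps; rewrite inE qs orbT.
by rewrite inE => /orP[/eqP->|/ws//]; move: wp; rewrite /= in_itv.
Qed.

Lemma open_box_open s : open (open_box s).
Proof.
elim: s => [|p s ih]; first by rewrite open_box_nil; exact: openT.
rewrite open_box_cons; apply: openI => //.
have /continuousP := @conductance_continuous p.1; apply; exact: interval_open.
Qed.

Lemma closed_box_closed s : closed (closed_box s).
Proof.
have -> : closed_box s = \bigcap_(p in [set` s])
    coord p.1 @^-1` `[ratr p.2.1, ratr p.2.2].
  by apply/seteqP; split=> w ws p /ws; rewrite /= in_itv.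
apply: closed_bigI => p _; apply: closed_comp; last exact: interval_closed.
by move=> w _; exact: conductance_continuous.
Qed.

Lemma open_box_sub s : open_box s `<=` closed_box s.
Proof. by move=> w ws p /ws/andP[/ltW -> /ltW ->]. Qed.

(** The closed boxes around [w] generate a filter that converges to [w] coordinate by coordinate.
    Having the open box around [w] and the closed one inside [U] yields regularity as well. *)
Lemma box_base (w : Omega) (U : set Omega) : nbhs w U ->
  exists s, [/\ positive_box s, open_box s w & closed_box s `<=` U].
Proof.
pose G := filter_from [set s | positive_box s /\ open_box s w] closed_box.
have FG : Filter G.
  apply: filter_from_filter; first by exists [::].
  move=> s t [ps ws] [pt wt]; exists (s ++ t).
    rewrite /positive_box/= all_cat; split; first exact/andP.
    by rewrite open_box_cat.
  by move=> v vst; split=> p pst; apply: vst; rewrite mem_cat pst ?orbT.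
have Gw : G --> w.
  apply: Omega_cvg => e A /nbhs_ballP[r /= r0 rA].
  (* The maximum with 0 forces the lower endpoint to be positive. *)
  have [a] : exists a,
      ratr a \in `]Num.max 0 (conductance w e - r), conductance w e[.
    apply: rat_in_itvoo; rewrite gt_max conductance_gt0/=.
    by rewrite ltrBlDr ltrDl.
  rewrite in_itv/= gt_max => /andP[/andP[a0 ra] aw].
  have [b] : exists b, ratr b \in `]conductance w e, conductance w e + r[.
    by apply: rat_in_itvoo; rewrite ltrDl.
  rewrite in_itv/= => /andP[wb br].
  exists [:: (e, (a, b))].
    rewrite /positive_box/= andbT -(ltr0q R); split=> // p.
    by rewrite inE => /eqP ->/=; rewrite aw wb.
  move=> v /(_ (e, (a, b)))/=; rewrite inE eqxx => /(_ isT)/andP[av vb].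
  apply: rA; rewrite /ball/= ltr_norml; lra.
by move=> /Gw [s [ps ws] sU]; exists s.
Qed.

Lemma Omega_regular : regular_space Omega.
Proof.
move=> w U /box_base[s [_ ws sU]]; exists (open_box s).
  by apply: open_nbhs_nbhs; split=> //; exact: open_box_open.
apply: subset_trans sU.
by rewrite [X in _ `<=` X](closure_id _).1;
  [exact/closureS/open_box_sub|exact: closed_box_closed].
Qed.

Lemma open_bigcup_box (U : set Omega) : open U ->
  U = \bigcup_(s in [set s | positive_box s /\ open_box s `<=` U]) open_box s.
Proof.
move=> oU; apply/seteqP; split=> [w Uw|w [s [_]]]; last exact.
have [s [ps ws sU]] := box_base (open_nbhs_nbhs (conj oU Uw)).
by exists s => //; split=> //; exact: subset_trans (@open_box_sub s) sU.
Qed.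

Definition positive_boxes : set (set Omega) :=
  [set open_box s | s in positive_box].

Lemma open_sigma_boxes (U : set Omega) : open U -> <<s positive_boxes >> U.
Proof.
(* The union now runs over the countable type of all [s], with empty terms for the boxes left
   out. *)
move=> /open_bigcup_box ->; rewrite bigcup_mkcond.
apply: (@countable_bigcupT_measurable _ (g_sigma_algebraType positive_boxes)).
  exact: countableP.
move=> s; case: ifPn => [/set_mem[ps _]|_]; last exact: measurable0.
by apply: sub_sigma_algebra; exists s.
Qed.

Lemma conductance_measurable e :
  measurable_fun setT (coord e).
Proof.
move=> _ B mB; rewrite setTI; apply: sub_sigma_algebra.
by exists e => //; exists B; rewrite ?setTI.
Qed.

Lemma open_box_measurable s : measurable (open_box s).
Proof.
elim: s => [|p s ih]; first by rewrite open_box_nil.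
rewrite open_box_cons; apply: measurableI => //.
by rewrite -[X in measurable X]setTI; exact: conductance_measurable.
Qed.

Lemma open_measurable_Omega (U : set Omega) : open U -> measurable U.
Proof.
move=> /open_sigma_boxes; apply: smallest_sub.
  exact: sigma_algebra_measurable.
by move=> _ [s _ <-]; exact: open_box_measurable.
Qed.

Lemma continuous_measurable_Omega (f : Omega -> R) :
  continuous f -> measurable_fun setT f.
Proof.
move=> /continuousP cf; apply: (measurability _ (RGenOpens.measurableE R)).
move=> _ [_ [a [b ->] <-]]; rewrite setTI; apply: open_measurable_Omega.
exact/cf/interval_open.
Qed.

(** Preimages of open intervals under a conductance are open, hence countable unions of positive
    boxes; so the boxes generate all events. *)
Lemma measurable_sigma_boxes (A : set Omega) :
  measurable A -> <<s positive_boxes >> A.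
Proof.
apply: smallest_sub; first exact: smallest_sigma_algebra.
move=> _ [e _ [B mB <-]].
have mc : measurable_fun setT
    (fun w : g_sigma_algebraType positive_boxes => conductance w e).
  apply: (measurability _ (RGenOpens.measurableE R)).
  move=> _ [_ [a [b ->] <-]]; rewrite setTI; apply: open_sigma_boxes.
  have /continuousP := @conductance_continuous e; apply; exact: interval_open.
exact: mc.
Qed.

End configuration_topology.

(** * Bump functions *)

Section bump_functions.
Context {R : realType} {d : nat}.
Local Notation Omega := (Omega R d).
Local Notation edge := (edge d).
Local Notation coord e := (fun w : Omega => conductance w e).

Lemma compact_posreal_itv (a b : R) : 0 < a ->
  compact [set x : posreal R | a <= val x <= b].
Proof.
move=> a0; rewrite compact_ultra => F FU FA.
have FvU : UltraFilter (val @ F) by exact: fmap_ultra.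
have := @segment_compact R a b; rewrite compact_ultra.
move=> /(_ _ FvU)[|x [xI Fx]].
  change (F (val @^-1` `[a, b])).
  by apply: filterS FA => w; rewrite /= in_itv.
have x0 : 0 < x.
  by move: xI; rewrite /= in_itv/= => /andP[+ _]; exact: lt_le_trans.
exists (exist _ x (mem_set x0)); split; last exact: posreal_cvg.
by move: xI; rewrite /= in_itv.
Qed.

(** Smallest margin to the faces of the box, capped at 1; it is positive exactly on the open box. *)
Definition box_depth (s : seq (box_datum d)) (c : edge -> R) : R :=
  \big[Num.min/1]_(p <- s)
    Num.min (c p.1 - ratr p.2.1) (ratr p.2.2 - c p.1).

(** A ramp of slope [k] in the depth. Its argument is any function on edges rather than a
    configuration, so that it can be evaluated on data given on finitely many edges only. *)
Definition bump (s : seq (box_datum d)) (k : nat) (c : edge -> R) : R :=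
  Num.max 0 (Num.min 1 (k%:R * box_depth s c)).

Lemma box_depth_gt0 s c : (0 < box_depth s c) =
  all (fun p => ratr p.2.1 < c p.1 < ratr p.2.2) s.
Proof.
rewrite /box_depth; elim: s => [|p s ih]; first by rewrite big_nil ltr01.
by rewrite big_cons/= !lt_min ih !subr_gt0.
Qed.

Lemma bump_ge0 s k c : 0 <= bump s k c.
Proof. by rewrite /bump le_max lexx. Qed.

Lemma bump_le1 s k c : bump s k c <= 1.
Proof. by rewrite /bump ge_max ler01 ge_min lexx. Qed.

Lemma bump_neq0 s k c : bump s k c != 0 -> 0 < box_depth s c.
Proof.
apply: contraNT; rewrite -leNgt => c0; apply/eqP/max_idPl.
by rewrite ge_min mulr_ge0_le0 ?orbT.
Qed.

Lemma eq_bump s k (c c' : edge -> R) :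
  (forall p, p \in s -> c p.1 = c' p.1) -> bump s k c = bump s k c'.
Proof.
move=> cc'; congr (Num.max 0 (Num.min 1 (_ * _))).
by apply: eq_big_seq => p ps; rewrite cc'.
Qed.

Lemma bump_continuous s k :
  continuous (fun w : Omega => bump s k (conductance w)).
Proof.
have cd : continuous (fun w : Omega => box_depth s (conductance w)).
  rewrite /box_depth; elim: s => [|p s ih] w.
    by under eq_fun do rewrite big_nil; exact: cst_continuous.
  under eq_fun do rewrite big_cons.
  apply: (@continuous_min R Omega
    (fun v => Num.min (conductance v p.1 - _) (_ - conductance v p.1))).
    apply: (@continuous_min R Omega (fun v => conductance v p.1 - _)
      (fun v => _ - conductance v p.1)).
      apply: (@continuousB _ R^o Omega (coord p.1) (cst _)).
        exact: conductance_continuous.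
      exact: cst_continuous.
    apply: (@continuousB _ R^o Omega (cst _) (coord p.1)).
      exact: cst_continuous.
    exact: conductance_continuous.
  exact: ih.
move=> w; apply: (@continuous_max R Omega (cst 0)
  (fun v => Num.min 1 (k%:R * box_depth s (conductance v)))).
  exact: cst_continuous.
apply: (@continuous_min R Omega (cst 1)
  (fun v => k%:R * box_depth s (conductance v))).
  exact: cst_continuous.
apply: (@continuousM _ Omega (cst _)
  (fun v => box_depth s (conductance v))); last exact: cd.
exact: cst_continuous.
Qed.

(** Where the bump is nonzero, each listed coordinate lies in a compact interval of positive reals;
    by Tychonoff the support sits in a compact product. *)
Lemma bump_Cloc s k : positive_box s ->
  Cloc (fun w : Omega => bump s k (conductance w)).
Proof.
move=> ps; split; first exact: bump_continuous.
pose B : set edge := [set` map fst s].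
(* Extends [u] by 1 outside [B]; a bump reads only the edges listed in [s], so it keeps its value on
   restrictions of configurations. *)
pose ext (u : {ptws set_type B -> posreal R}) e : R :=
  oapp (fun i => val (u i)) 1 (insub e).
have extE u (i : set_type B) : ext u (val i) = val (u i).
  by rewrite /ext valK.
exists B, (fun u => bump s k (ext u)); split.
- exact: finite_seq.
- move=> w; apply: eq_bump => p ps'.
  have Bp : p.1 \in B by apply: mem_set => /=; exact: map_f.
  by rewrite -[p.1]/(val (exist (fun e => e \in B) p.1 Bp)) extE.
have datum (i : set_type B) : exists p, p \in s /\ p.1 = val i.
  by have /set_mem/=/mapP[p ps' ->] := valP i; exists p.
(* An edge may occur several times in [s]; one interval per edge is enough to enclose the
   support. *)
have [q qP] := choice datum.
pose A (i : set_type B) :=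
  [set x : posreal R | ratr (q i).2.1 <= val x <= ratr (q i).2.2].
pose C := [set u : {ptws set_type B -> posreal R} | forall i, A i (u i)].
have cC : compact C.
  apply: (@tychonoff (set_type B) (fun=> posreal R)) => i.
  apply: compact_posreal_itv; have [qs _] := qP i.
  by rewrite ltr0q (allP ps _ qs).
apply: subclosed_compact cC _; first exact: closed_closure.
have clC : closed C.
  have -> : C = \bigcap_i (@proj _ (fun=> posreal R) i @^-1` A i).
    by apply/seteqP; split=> u uC i => [_|]; exact: uC.
  apply: closed_bigI => i _; apply: closed_comp.
    by move=> u _; exact: (@proj_continuous _ (fun=> posreal R)).
  have -> : A i = val @^-1` `[ratr (q i).2.1, ratr (q i).2.2].
    by apply/seteqP; split=> x; rewrite /A/= in_itv.
  apply: closed_comp; last exact: interval_closed.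
  by move=> u _; exact: posreal_val_continuous.
rewrite [X in _ `<=` X](closure_id _).1//; apply: closureS => u /= gu i.
have := bump_neq0 gu; rewrite box_depth_gt0 => /allP.
have [qs qi] := qP i; move=> /(_ _ qs); rewrite qi extE /A/=.
by move=> /andP[/ltW-> /ltW->].
Qed.

(** The sequence is eventually constant: it equals 1 once [k] exceeds the inverse of a positive
    depth, and 0 if the depth is not positive. *)
Lemma bump_cvg s (w : Omega) :
  bump s k (conductance w) @[k --> \oo] --> (\1_(open_box s) w : R).
Proof.
have sE : (w \in open_box s) = (0 < box_depth s (conductance w)).
  rewrite box_depth_gt0; apply/idP/allP => [/set_mem ws p /ws //|ws].
  exact: mem_set.
apply: cvg_near_cst; rewrite indicE sE; case: ltP => [d0|d0].
  near=> k; rewrite /bump; have k1 : 1 <= k%:R * box_depth s (conductance w).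
    rewrite -ler_pdivrMr// mul1r; apply: ltW; near: k.
    exact: nbhs_infty_gtr.
  by rewrite (min_idPl k1); apply/max_idPr.
apply: nearW => k; apply/eqP; apply: contraT => /bump_neq0.
by rewrite ltNge d0.
Unshelve. all: by end_near. Qed.

Lemma probability_open_box (P : probability Omega R) s :
  ('E_P[fun w => bump s k (conductance w)]%R @[k --> \oo] --> P (open_box s))%E.
Proof.
have -> : P (open_box s) = (\int[P]_w (\1_(open_box s) w)%:E)%E.
  by rewrite integral_indic// ?setIT//; exact: open_box_measurable.
rewrite expectation.unlock.
apply: (@dominated_cvg _ Omega R P setT measurableT _ _ (cst 1%E)) => //.
- move=> k; apply/measurable_EFinP; apply: continuous_measurable_Omega.
  exact: bump_continuous.
- by move=> w _; apply/fine_cvgP; split; [exact: nearW|exact: bump_cvg].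
- exact: finite_measure_integrable_cst.
- by move=> k w _; rewrite abse_EFin lee_fin ger0_norm ?bump_le1 ?bump_ge0.
Qed.

Lemma bump_Cb s k : Cb (fun w : Omega => bump s k (conductance w)).
Proof.
split; first exact: bump_continuous.
exists 1; split=> [|M M1 w _]; first exact: num_real.
by rewrite /= ger0_norm ?bump_ge0// (le_trans (bump_le1 _ _ _) (ltW M1)).
Qed.

(** By dominated convergence the means of bumps give the masses of positive boxes, a generating
    family that concatenation makes stable under intersection. *)
Lemma bumps_determine (P Q : probability Omega R) :
  (forall s k, positive_box s -> 'E_P[fun w => bump s k (conductance w)] =
    'E_Q[fun w => bump s k (conductance w)])%E -> same_law P Q.
Proof.
move=> PQ A /measurable_sigma_boxes.
apply: (g_sigma_algebra_measure_unique _ _ (fun=> setT)).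
- by move=> _ [s _ <-]; exact: open_box_measurable.
- by move=> _; exists [::] => //; exact: open_box_nil.
- exact: bigcup_const.
- move=> _ _ [s ps <-] [t pt <-]; exists (s ++ t); last exact: open_box_cat.
  by rewrite /positive_box/= all_cat; exact/andP.
- move=> _ [s ps <-].
  change (P (open_box s) = Q (open_box s)).
  have /cvg_lim <-// := @probability_open_box P s.
  have /cvg_lim <-// := @probability_open_box Q s.
  by congr (limn _); apply/funext => k; exact: PQ.
- by move=> _; rewrite [ltLHS](_ : _ = 1%E) ?ltry//; exact: probability_setT.
Qed.

End bump_functions.

(** * Lattice boxes *)

Section finite_sums.
Context {R : realType} {I : choiceType}.
Implicit Types (S L : {fset I}) (h : I -> R).

Lemma sum_fset_diff S L h : (S `<=` L)%fset ->
  \sum_(x <- L) h x = \sum_(x <- S) h x + \sum_(x <- (L `\` S)%fset) h x.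
Proof.
move=> SL; rewrite (big_fsetID _ (mem S) L)/=; congr (_ + _);
  apply: eq_fbigl => x.
  by rewrite !inE/= andbC; case: (boolP (x \in S)) => //= /(fsubsetP SL) ->.
by rewrite !inE/= andbC.
Qed.

Lemma ler_sum_fset S L h : (S `<=` L)%fset -> (forall x, 0 <= h x) ->
  \sum_(x <- S) h x <= \sum_(x <- L) h x.
Proof. by move=> SL h0; rewrite (sum_fset_diff _ SL) lerDl sumr_ge0. Qed.

(** Only the terms indexed by [L] minus [S] survive, and their number is the difference of the
    cardinals. *)
Lemma sum_fset_dist S L h M : (S `<=` L)%fset -> (forall x, `|h x| <= M) ->
  `|\sum_(x <- L) h x - \sum_(x <- S) h x| <= M * (#|` L|%:R - #|` S|%:R).
Proof.
move=> SL hM.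
have card (A : {fset I}) : #|` A|%:R = \sum_(x <- A) (1 : R).
  by rewrite big_const_seq count_predT iter_addr addr0.
rewrite !card !(sum_fset_diff _ SL) !(addrAC _ _ (- _)) !subrr !add0r mulr_sumr.
by rewrite (le_trans (ler_norm_sum _ _ _))// ler_sum// => x _; rewrite mulr1.
Qed.

End finite_sums.

Section lattice_boxes.
Context {d : nat}.
Local Notation edge := (edge d).

(** This parametrization of [Lambda d n] gives both its finiteness and its cardinal. *)
Definition lattice_point (n : nat) (g : {ffun 'I_d -> 'I_(n.*2.+1)}) :
    'rV[int]_d :=
  \row_i ((g i)%:Z - n%:Z).

Lemma lattice_point_inj n : injective (@lattice_point n).
Proof.
move=> g h /rowP gh; apply/ffunP => i; apply/val_inj.
by have := gh i; rewrite !mxE => /addIr[].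
Qed.

Lemma LambdaE n : Lambda d n =
  [set` [fset lattice_point g | g in {ffun 'I_d -> 'I_(n.*2.+1)}]%fset].
Proof.
apply/seteqP; split=> [x xn|_ /= /imfsetP[g _ ->] i]; last first.
  by rewrite mxE; case: (g i) => k /= kn; lia.
have xn' i : (absz (x 0 i + n%:Z)%R < n.*2.+1)%N by have := xn i; lia.
apply/imfsetP; exists [ffun i => Ordinal (xn' i)] => //.
by apply/rowP => i; rewrite mxE ffunE/=; have := xn i; lia.
Qed.

Lemma finite_Lambda n : finite_set (Lambda d n).
Proof. by rewrite LambdaE. Qed.

Lemma card_Lambda n : #|` fset_set (Lambda d n)| = (n.*2.+1 ^ d)%N.
Proof.
rewrite LambdaE set_fsetK card_imfset; last exact: lattice_point_inj.
by rewrite -cardE card_ffun !card_ord.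
Qed.

Lemma mem_Lambda n x : (x \in fset_set (Lambda d n)) = (x \in Lambda d n).
Proof. by rewrite in_fset_set//; exact: finite_Lambda. Qed.

Lemma Lambda_subset m n : (m <= n)%N ->
  (fset_set (Lambda d m) `<=` fset_set (Lambda d n))%fset.
Proof.
move=> mn; apply/fsubsetP => x; rewrite !mem_Lambda => /set_mem xm.
by apply: mem_set => i; rewrite (le_trans (xm i))// lez_nat.
Qed.

Lemma Lambda_exhaust (x : 'rV[int]_d) : exists r, Lambda d r x.
Proof.
exists (\sum_i absz (x 0%R i))%N => i; rewrite -abszE lez_nat.
by rewrite (bigD1 i)//= leq_addr.
Qed.

Lemma LambdaD n r (x y : 'rV[int]_d) :
  Lambda d n x -> Lambda d r y -> Lambda d (n + r) (x + y).
Proof.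
move=> xn yr i; rewrite mxE PoszD (le_trans (ler_normD _ _))//.
by rewrite lerD.
Qed.

(** Adjacent vertices differ by at most 1 in each coordinate, so both ends of such an edge lie in
    the box of radius [n.+1]. *)
Lemma finite_incident_edges n : finite_set (incident_edges (Lambda d n)).
Proof.
pose L := Lambda d n.+1.
have fL : finite_set ((fun e : edge => val e) @^-1` (L `*` L)%classic).
  apply: finite_preimage; first by move=> e e' _ _; exact: val_inj.
  by apply: finite_setX; exact: finite_Lambda.
apply: sub_finite_set fL => e eL.
have eadj i : `|(val e).1 0 i - (val e).2 0 i| <= 1.
  have /eqP <- := valP e; rewrite (bigD1 i)//= lerDl.
  by apply: sumr_ge0 => j _.
by split=> i; have := eadj i; case: eL => /(_ i); lia.
Qed.

Lemma edge_shift_inj (e : edge) :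
  injective (fun x : 'rV[int]_d => edge_shift x e).
Proof. by move=> x y [] /addrI. Qed.

End lattice_boxes.

(** * Spatial averages *)

Section spatial_averages.
Context {R : realType} {d : nat} (w : Omega R d).
Local Notation Omega := (Omega R d).
Implicit Types (f g : Omega -> R) (n : nat).

Let volume n : R := (n.*2.+1)%:R ^+ d.

Let volume_gt0 n : 0 < volume n.
Proof. by rewrite exprn_gt0. Qed.

Let card_volume n : #|` fset_set (Lambda d n)|%:R = volume n.
Proof. by rewrite card_Lambda natrX. Qed.

Lemma spatial_averageE f n : spatial_average f w n =
  (\sum_(x <- fset_set (Lambda d n)) f (tau x w)) / volume n.
Proof.
rewrite /spatial_average card_volume fsbig_finite//; exact: finite_Lambda.
Qed.

Lemma spatial_average_le f g n : (forall v, f v <= g v) ->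
  spatial_average f w n <= spatial_average g w n.
Proof.
by move=> fg; rewrite !spatial_averageE ler_pM2r ?invr_gt0// ler_sum.
Qed.

Lemma spatial_averageD f g n : spatial_average (fun v => f v + g v) w n =
  spatial_average f w n + spatial_average g w n.
Proof. by rewrite !spatial_averageE big_split mulrDl. Qed.

Lemma spatial_averageZ c f n :
  spatial_average (fun v => c * f v) w n = c * spatial_average f w n.
Proof. by rewrite !spatial_averageE -mulr_sumr mulrA. Qed.

Lemma spatial_average_cst c n : spatial_average (cst c) w n = c.
Proof.
rewrite spatial_averageE big_const_seq count_predT iter_addr addr0.
by rewrite -mulr_natr card_volume mulfK// gt_eqF.
Qed.

Lemma spatial_average_sum (N : nat) (F : nat -> Omega -> R) n :
  spatial_average (fun v => \sum_(k < N) F k v) w n =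
  \sum_(k < N) spatial_average (F k) w n.
Proof.
rewrite spatial_averageE exchange_big mulr_suml.
by apply: eq_bigr => k _; rewrite spatial_averageE.
Qed.

Lemma tauD (x y : 'rV[int]_d) (v : Omega) : tau y (tau x v) = tau (x + y) v.
Proof.
apply: conductance_inj => e; rewrite /conductance/=; congr (val (val v _)).
by apply: val_inj; rewrite /= -!addrA (addrC y).
Qed.

Lemma tau_continuous x : continuous (@tau R d x).
Proof.
move=> v; apply: Omega_cvg; first exact: (fmap_filter _ (nbhs_filter v)).
by move=> e; exact: (@conductance_continuous _ _ (edge_shift x e) v).
Qed.

(** The ratio is the [d]-th power of [1 + 2r / (2n + 1)]. *)
Lemma volume_ratio_cvg r : volume (n + r) / volume n @[n --> \oo] --> (1 : R).
Proof.
have inv0 : (n.*2.+1)%:R^-1 @[n --> \oo] --> (0 : R).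
  apply: (@squeeze_cvgr _ _ _ _ (cst 0) (@harmonic R)).
  - apply: nearW => n /=; rewrite invr_ge0 ler0n/= lef_pV2 ?posrE//.
    by rewrite ler_nat -addnn; lia.
  - exact: cvg_cst.
  - exact: cvg_harmonic.
have : (1 + r.*2%:R * (n.*2.+1)%:R^-1) ^+ d @[n --> \oo] -->
    ((1 + r.*2%:R * 0) ^+ d : R).
  apply: (@cvg_comp _ _ _ (fun n => 1 + r.*2%:R * (n.*2.+1)%:R^-1)
    (fun x : R => x ^+ d) _ (nbhs (1 + r.*2%:R * 0 : R)));
    last exact: exprn_continuous.
  by apply: cvgD; [exact: cvg_cst|apply: cvgMr].
rewrite mulr0 addr0 expr1n; apply: cvg_trans; apply: near_eq_cvg.
apply: nearW => n; rewrite /volume -expr_div_n; congr (_ ^+ _).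
have -> : ((n + r).*2.+1)%:R = (n.*2.+1)%:R + r.*2%:R :> R.
  by rewrite -natrD doubleD addSn.
by rewrite mulrDl divff// pnatr_eq0.
Qed.

(** The box of radius [n] and its translate by [y] both lie in the box of radius [n + r]. Each of
    the two sums differs from the sum over the large box by at most [M] times the difference of
    volumes. *)
Lemma spatial_average_shift (f : Omega -> R) (M : R) (y : 'rV[int]_d) :
  (forall v, `|f v| <= M) ->
  spatial_average (f \o tau y) w n - spatial_average f w n
    @[n --> \oo] --> (0 : R).
Proof.
move=> fM; have [r yr] := Lambda_exhaust y.
pose h x := f (tau x w); have hM x : `|h x| <= M by exact: fM.
suff bound n : `|spatial_average (f \o tau y) w n - spatial_average f w n| <=
    2 * M * (volume (n + r) / volume n - 1).
  apply/norm_cvg0P; apply: (@squeeze_cvgr _ _ _ _ (cst 0)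
    (fun n => 2 * M * (volume (n + r) / volume n - 1))).
  - by apply: nearW => n; rewrite normr_ge0 bound.
  - exact: cvg_cst.
  - rewrite -[X in _ --> X](mulr0 (2 * M)); apply: cvgMr.
    rewrite -[X in _ --> X](subrr 1); apply: cvgB; last exact: cvg_cst.
    exact: volume_ratio_cvg.
pose S := fset_set (Lambda d n); pose L := fset_set (Lambda d (n + r)).
pose S' := [fset (x + y)%R | x in S]%fset.
have SL : (S `<=` L)%fset by apply: Lambda_subset; rewrite leq_addr.
have S'L : (S' `<=` L)%fset.
  apply/fsubsetP => _ /imfsetP[x /= + ->]; rewrite !mem_Lambda => /set_mem xn.
  by apply: mem_set; exact: LambdaD.
have -> : spatial_average (f \o tau y) w n = (\sum_(x <- S') h x) / volume n.
  rewrite spatial_averageE big_imfset/=; last by move=> ? ? _ _ /addIr.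
  by congr (_ / _); apply: eq_bigr => x _; rewrite tauD.
rewrite spatial_averageE -/S -mulrBl normrM [X in _ * X]gtr0_norm ?invr_gt0//.
rewrite ler_pdivrMr// -[leRHS]mulrA mulrBl mul1r divfK ?gt_eqF//.
have := sum_fset_dist SL hM; have := sum_fset_dist S'L hM.
rewrite card_imfset/=; last by move=> ? ? /addIr.
rewrite !card_volume => h1 h2.
rewrite -(subrKA (\sum_(x <- L) h x)) (le_trans (ler_normD _ _))//.
by rewrite distrC -mulrA mulr_natl mulr2n lerD.
Qed.

End spatial_averages.

(** * Tightness *)

Lemma seq_lower_bound {R : realType} {I : eqType} (s : seq I) (g : I -> R) :
  (forall i, 0 < g i) -> exists2 e, 0 < e & forall i, i \in s -> e <= g i.
Proof.
move=> g0; elim: s => [|i s [e e0 es]]; first by exists 1.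
exists (Num.min (g i) e); first by rewrite lt_min g0.
by move=> j; rewrite inE ge_min => /predU1P[->|/es ->]; rewrite ?lexx ?orbT.
Qed.

Lemma sum_half_powers (R : realType) N :
  \sum_(k < N) (2 ^- k.+1 : R) = 1 - 2 ^- N.
Proof.
elim: N => [|N ih]; first by rewrite big_ord0 expr0 invr1 subrr.
by rewrite big_ord_recr/= ih exprS invfM; lra.
Qed.

Section tightness.
Context {R : realType} {d : nat} (w : Omega R d).
Local Notation Omega := (Omega R d).
Local Notation edge := (edge d).

Definition outlier (eps : R) (e : edge) (v : Omega) : R :=
  \1_(~` `[eps, eps^-1]%classic) (conductance v e).

Lemma outlierE a e v :
  outlier a e v = (~~ (a <= conductance v e <= a^-1))%:R.
Proof. by rewrite /outlier indicE in_setC mem_setE in_itv. Qed.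

Lemma outlier_le (a b : R) e v : 0 < a -> a <= b ->
  outlier a e v <= outlier b e v.
Proof.
move=> a0 ab; have b0 := lt_le_trans a0 ab; rewrite !outlierE ler_nat.
have [/andP[bc cb]|_] := boolP (b <= _ <= _); last exact: leq_b1.
by rewrite (le_trans ab bc) (le_trans cb)// lef_pV2.
Qed.

Lemma outlier_ge0 a e v : 0 <= outlier a e v.
Proof. by rewrite /outlier indicE. Qed.

Lemma outlier_eq0 a e v : a <= conductance v e -> a <= (conductance v e)^-1 ->
  0 < a -> outlier a e v = 0.
Proof.
move=> h1 h2 a0; rewrite outlierE h1/= -[conductance v e]invrK.
by rewrite lef_pV2 ?posrE ?h2// invr_gt0 conductance_gt0.
Qed.

(** The shifts of [e] by the points of [Lambda d n] are distinct edges incident with the box of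
    radius [n + r], so the sum defining the density dominates. *)
Lemma spatial_average_outlier (e : edge) (eps : R) : exists r,
  forall n, (r < n)%N ->
    spatial_average (outlier eps e) w n <= outlier_density w eps (n + r).
Proof.
have [r er] := Lambda_exhaust (val e).1; exists r => n rn.
pose bad e' : R := \1_(~` `[eps, eps^-1]%classic) (conductance w e').
have bad0 e' : 0 <= bad e' by rewrite /bad indicE.
pose S := fset_set (Lambda d n).
pose L := fset_set (incident_edges (Lambda d (n + r))).
pose S' := [fset edge_shift x e | x in S]%fset.
have S'L : (S' `<=` L)%fset.
  apply/fsubsetP => _ /imfsetP[x /= + ->]; rewrite mem_Lambda => /set_mem xn.
  rewrite in_fset_set; last exact: finite_incident_edges.
  by apply: mem_set; left => /=; rewrite addrC; exact: LambdaD.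
have -> : spatial_average (outlier eps e) w n =
    (\sum_(e' <- S') bad e') / (n.*2.+1)%:R ^+ d.
  rewrite spatial_averageE big_imfset//= => x y _ _.
  exact: (@edge_shift_inj _ e x y).
rewrite /outlier_density fsbig_finite; last exact: finite_incident_edges.
apply: ler_pM; first exact: sumr_ge0.
- by rewrite invr_ge0 exprn_ge0.
- exact: (ler_sum_fset S'L).
(* The normalizations compare because [r < n] gives [0 < n + r <= 2n + 1]. *)
- rewrite lef_pV2 ?posrE ?exprn_gt0// ?ltr0n; last lia.
  by rewrite lerXn2r ?nnegrE// ler_nat -addnn; lia.
Qed.

(** The limsup controls all large [n]. For the finitely many others, [eps] is lowered until no shift
    involved has an outlier at [e]. *)
Lemma edge_tight (e : edge) (dl : R) : tight w -> 0 < dl ->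
  exists2 eps, 0 < eps & forall n, spatial_average (outlier eps e) w n <= dl.
Proof.
move=> w_tight dl0.
have near0 : \forall eps \near 0^'+,
    (limn_esup (fun n => (outlier_density w eps n)%:E) < dl%:E)%E.
  have dl0' : (0%E < dl%:E)%E by rewrite lte_fin.
  exact: w_tight _ (open_ereal_lt' dl0').
have [a [a0 ha]] : exists a : R, 0 < a /\
    (limn_esup (fun n => (outlier_density w a n)%:E) < dl%:E)%E.
  near (0 : R)^'+ => a; exists a; split; last by near: a.
  by near: a; exact: nbhs_right_gt.
(* A limsup is an infimum of suprema over neighborhoods of infinity, so some tail already stays
   below [dl]. *)
have [_ [V [N _ NV] <-] Vdl] := ereal_inf_lt ha.
have {Vdl NV}Na n : (N <= n)%N -> outlier_density w a n <= dl.
  move=> Nn; rewrite -lee_fin (le_trans _ (ltW Vdl))//.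
  by apply: ereal_sup_ubound; exists n => //; exact: NV.
have [r ra] := spatial_average_outlier e a.
pose N' := maxn N r.+1.
(* [b] bounds from below both the conductances and their inverses, hence excludes outliers on either
   side when [n <= N']. *)
have [b b0 hb] := @seq_lower_bound R _ (fset_set (Lambda d N'))
  (fun x => Num.min (conductance (tau x w) e) (conductance (tau x w) e)^-1)
  (fun x => ltac:(by rewrite lt_min invr_gt0 !conductance_gt0)).
have c0 : 0 < Num.min a b by rewrite lt_min a0.
exists (Num.min a b) => // n; have [nN|Nn] := leqP n N'.
  rewrite spatial_averageE big_seq big1 ?mul0r ?ltW// => x xn.
  have := hb x (fsubsetP (Lambda_subset nN) _ xn).
  rewrite le_min => /andP[h1 h2].
  by apply: outlier_eq0; rewrite // ge_min ?h1 ?h2 orbT.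
apply: (@le_trans _ _ (spatial_average (outlier a e) w n)).
  by apply: spatial_average_le => v; apply: outlier_le; rewrite // ge_min lexx.
apply: (le_trans (ra n _)); first by move: Nn; rewrite /N'; lia.
by apply: Na; move: Nn; rewrite /N'; lia.
Unshelve. all: by end_near. Qed.

(** The edge with code [k] gets the error budget [dl / 2 ^ k.+1]. A configuration outside the
    resulting compact box has an outlier at some edge, and the budgets sum to at most [dl]. *)
Lemma spatial_average_tight (dl : R) : tight w -> 0 < dl ->
  exists2 K : set Omega, compact K &
    forall n, spatial_average \1_(~` K) w n <= dl.
Proof.
move=> w_tight dl0.
have tight_e (e : edge) : exists a, 0 < a /\ forall n,
    spatial_average (outlier a e) w n <= dl * 2 ^- (choice.pickle e).+1.
  have dle : 0 < dl * 2 ^- (choice.pickle e).+1 by rewrite divr_gt0// exprn_gt0.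
  by have [a a0 ha] := @edge_tight e _ w_tight dle; exists a.
have [eps epsP] := choice tight_e.
exists [set v : Omega | forall e, eps e <= conductance v e <= (eps e)^-1].
  by apply: compact_box => e; have [] := epsP e.
set K := [set v : Omega | _] => n.
(* Reindexes the outliers by the codes of edges, with value 0 at codes of no edge. *)
pose F k (v : Omega) : R :=
  oapp (fun e => outlier (eps e) e v) 0 (pickle_inv k).
have F0 k v : 0 <= F k v.
  by rewrite /F; case: pickle_inv => //= e; exact: outlier_ge0.
have FP v : exists k, ~ K v -> F k v = 1.
  have [Kv|] := pselect (K v); first by exists 0%N.
  move=> /existsNP[e he]; exists (choice.pickle e) => _.
  by rewrite /F pickleK_inv/= outlierE; move/negP: he => ->.
have [k kP] := choice FP.
pose S := fset_set (Lambda d n).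
(* For fixed [n] only finitely many shifts occur, so a finite sum bounds the indicator at all of
   them. [N] depends on [n], but the final bound does not. *)
pose N := (\max_(x <- S) k (tau x w)).+1.
apply: (@le_trans _ _ (spatial_average (fun v => \sum_(k < N) F k v) w n)).
  rewrite !spatial_averageE ler_pM2r ?invr_gt0 ?exprn_gt0//.
  rewrite big_seq [leRHS]big_seq; apply: ler_sum => x xS.
  rewrite indicE; have [/set_mem Kv|_] := boolP (_ \in ~` K); last first.
    by apply: sumr_ge0.
  have kN : (k (tau x w) < N)%N.
    by rewrite ltnS; apply: (@leq_bigmax_seq _ _ _ (fun x => k (tau x w))).
  rewrite (bigD1 (Ordinal kN))//= kP//.
  by rewrite lerDl sumr_ge0.
rewrite spatial_average_sum.
apply: (@le_trans _ _ (\sum_(k < N) dl * 2 ^- k.+1)); last first.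
  rewrite -mulr_sumr sum_half_powers ler_piMr ?ltW// lerBlDr lerDl.
apply: ler_sum => i _; rewrite /F.
have := @pickle_invK edge i; case: pickle_inv => [e /= <-|_ /=].
  by have [_] := epsP e; apply.
rewrite spatial_average_cst; apply: mulr_ge0; first exact: ltW.
by rewrite invr_ge0 exprn_ge0.
Qed.

End tightness.

(** * From outer measures to probabilities and from ultrafilters to filters *)

Lemma outer_measure_probability {R : realType} dsp {T : measurableType dsp}
    (mu : {outer_measure set T -> \bar R}) :
  measurable `<=` mu.-caratheodory -> mu setT = 1%E ->
  exists P : probability T R, forall A, P A = mu A.
Proof.
move=> mcara mu1.
(* This is Caratheodory's theorem; the function packed below is [mu] itself, whence equality on all
   sets. *)
have sadd : semi_sigma_additive (mu : set T -> \bar R).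
  move=> F mF tF mUF; apply: (@caratheodory_measure_sigma_additive R T mu F);
    by [move=> i; exact: mcara|exact: mcara|].
pose mM := isMeasure.Build dsp T R mu (outer_measure0 mu)
  (outer_measure_ge0 mu) sadd.
pose M : {measure set T -> \bar R} := HB.pack (mu : set T -> \bar R) mM.
pose mP := Measure_isProbability.Build dsp T R M mu1.
pose P : probability T R := HB.pack (mu : set T -> \bar R) mM mP.
by exists P.
Qed.

(** A filter is the intersection of the ultrafilters above it: if [A] is not in [F], then [F]
    restricted to the complement of [A] is proper and extends to an ultrafilter that avoids [A]. *)
Lemma ultra_limit_le {T : Type} (F : set_system T) (A : set T) :
  Filter F -> (forall G, UltraFilter G -> F `<=` G -> G A) -> F A.
Proof.
move=> FF FA; apply: contrapT => nFA.
have WP : ProperFilter (within (~` A) F).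
  apply: Build_ProperFilter_ex => B FB.
  apply: contrapT => /forallNP nB; apply: nFA.
  move: FB; rewrite /within/=; apply: filterS => x xB.
  by apply: contrapT => /xB/nB.
have [G [GU WG]] := ultraFilterLemma WP.
have GA : G A.
  by apply: FA => // B FB; apply: WG; exact: (@cvg_within _ _ FF (~` A) _ FB).
have GCA : G (~` A) by apply: WG; exact: withinT.
by have [x []] := filter_ex (filterI GA GCA).
Qed.

(** * Staircase approximation of a real number *)

Section staircase.
Context {R : realType}.
Implicit Types (s : R) (N : nat).

(** For nonnegative [s] this is the minimum of [N] and the integer part of [s]. *)
Definition steps N s : R := \sum_(k < N) (k.+1%:R <= s)%R%:R.

Lemma steps_leN N s : steps N s <= N%:R.
Proof.
rewrite -[N in leRHS]card_ord -sumr_const ler_sum// => k _.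
by case: (_ <= s).
Qed.

Lemma steps_le N s : 0 <= s -> steps N s <= s.
Proof.
move=> s0; elim: N => [|N ih]; first by rewrite /steps big_ord0.
rewrite /steps big_ord_recr/= -/(steps N s).
have [Ns|_] := boolP (N.+1%:R <= s); last by rewrite addr0.
by rewrite (le_trans _ Ns)// -[N.+1]addn1 natrD lerD ?steps_leN.
Qed.

Lemma le_steps N s : s <= N%:R -> s <= steps N s + 1.
Proof.
elim: N => [|N ih] sN; rewrite /steps.
  by rewrite big_ord0 add0r (le_trans sN).
rewrite big_ord_recr/= -/(steps N s).
have [{}/ih sN'|Ns] := leP s N%:R.
  by rewrite (le_trans sN')// lerD2r lerDl ler0n.
rewrite (le_trans sN)// -[leLHS]natr1 lerD2r.
apply: (@le_trans _ _ (steps N s)); last by rewrite lerDl.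
rewrite /steps (eq_bigr (fun=> 1)) ?sumr_const ?card_ord// => k _.
by rewrite (le_trans _ (ltW Ns))// ler_nat.
Qed.

End staircase.

(** * Ultralimits of spatial averages *)

Lemma bounded_funE {T : Type} {R : realType} (f : T -> R) :
  bounded_fun f -> exists2 M, 0 < M & forall x, `|f x| <= M.
Proof.
move=> [M [_ hM]]; exists (`|M| + 1) => [|x]; first by rewrite ltr_wpDl.
by apply: hM => //; rewrite (le_lt_trans (ler_norm _))// ltrDl.
Qed.

(** * Integrals of bounded functions and of sums of indicators *)

Section integrals.
Context {R : realType} {d : nat} (P : probability (Omega R d) R).
Local Notation Omega := (Omega R d).

Lemma bounded_integrable (f : Omega -> R) M :
  measurable_fun setT f -> (forall v, `|f v| <= M) ->
  P.-integrable setT (EFin \o f).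
Proof.
move=> mf fM; apply: measurable_bounded_integrable => //.
  by rewrite [ltLHS](_ : _ = 1%E) ?ltry//; exact: probability_setT.
exists M; split=> [|N MN v _]; first exact: num_real.
exact: le_trans (fM v) (ltW MN).
Qed.

Lemma expectation_Rintegral (f : Omega -> R) M :
  measurable_fun setT f -> (forall v, `|f v| <= M) ->
  'E_P[f]%E = (\int[P]_v f v)%:E.
Proof.
move=> mf fM; rewrite expectation.unlock /Rintegral fineK//.
by apply: integrable_fin_num => //; exact: bounded_integrable fM.
Qed.

Lemma Rintegral_indicator (A : set Omega) : measurable A ->
  \int[P]_v (\1_A v : R) = fine (P A).
Proof. by move=> mA; rewrite /Rintegral integral_indic// setIT. Qed.

Lemma indicator_bound (A : set Omega) v : `|\1_A v : R| <= 1.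
Proof. by rewrite indicE ger0_norm// lern1 leq_b1. Qed.

Lemma sum_indicator_integrable N (A : nat -> set Omega) :
  (forall k, measurable (A k)) ->
  P.-integrable setT (EFin \o (fun v => \sum_(k < N) (\1_(A k) v : R))).
Proof.
move=> mA; apply: (@bounded_integrable _ N%:R).
  by apply: measurable_sum => k; exact: measurable_indic.
move=> v; rewrite (le_trans (ler_norm_sum _ _ _))//.
rewrite -[N in leRHS]card_ord -sumr_const ler_sum// => k _.
exact: indicator_bound.
Qed.

Lemma Rintegral_sum_indicator N (A : nat -> set Omega) :
  (forall k, measurable (A k)) ->
  \int[P]_v (\sum_(k < N) (\1_(A k) v : R)) = \sum_(k < N) fine (P (A k)).
Proof.
move=> mA; elim: N => [|N ih].
  under eq_Rintegral do rewrite big_ord0.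
  by rewrite big_ord0 Rintegral_cst// mul0r.
under eq_Rintegral do rewrite big_ord_recr/=.
rewrite RintegralD//; last 2 first.
- exact: sum_indicator_integrable.
- apply: (@bounded_integrable _ 1); first exact: measurable_indic.
  exact: indicator_bound.
by rewrite ih Rintegral_indicator// big_ord_recr.
Qed.

End integrals.

Section ultralimit.
Context {R : realType} {d : nat} (w : Omega R d) (U : set_system nat).
Hypotheses (U_ultra : UltraFilter U) (w_tight : tight w).
Local Notation Omega := (Omega R d).
Implicit Types (f : Omega -> R) (A B : set Omega).

Lemma ultra_limit_mono (u v : nat -> R) (a b : R) :
  u @ U --> a -> v @ U --> b -> (forall n, u n <= v n) -> a <= b.
Proof. by move=> ua vb uv; apply: (ler_cvg_to ua vb); exact: nearW. Qed.

Lemma ultra_limit_cst (a : R) : cst a @ U --> a.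
Proof. exact: cvg_cst. Qed.

Definition ultra_average f : R := lim (spatial_average f w @ U).

(** The averages stay in the compact interval from [- M] to [M], where every ultrafilter
    converges. *)
Lemma ultra_average_cvg f M : (forall v, `|f v| <= M) ->
  spatial_average f w @ U --> ultra_average f.
Proof.
move=> fM; have uU := fmap_ultra (spatial_average f w) U_ultra.
have := @segment_compact R (- M) M; rewrite compact_ultra.
move=> /(_ _ uU)[|l [_ Ul]].
  change (U (spatial_average f w @^-1` `[- M, M])).
  apply: (@filterS _ U _ setT); last exact: filterT.
  move=> n _; rewrite /= in_itv/=; apply/andP; split.
    rewrite -[leLHS](@spatial_average_cst _ _ w (- M) n).
    apply: spatial_average_le => v /=.
    by have := fM v; rewrite ler_norml => /andP[].
  rewrite -[leRHS](@spatial_average_cst _ _ w M n).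
  apply: spatial_average_le => v /=.
  by have := fM v; rewrite ler_norml => /andP[].
by rewrite /ultra_average (cvg_lim _ Ul).
Qed.

Definition ultra_content A : R := ultra_average \1_A.

Lemma ultra_content_cvg A :
  spatial_average \1_A w @ U --> ultra_content A.
Proof. by apply: ultra_average_cvg => v; exact: indicator_bound. Qed.

Lemma ultra_content_ge0 A : 0 <= ultra_content A.
Proof.
apply: (ultra_limit_mono (@ultra_limit_cst 0) (@ultra_content_cvg A)) => n.
rewrite -(spatial_average_cst w 0 n).
by apply: spatial_average_le => v; rewrite indicE.
Qed.

Lemma ultra_content_setT : ultra_content setT = 1.
Proof.
apply: (cvg_unique _ (@ultra_content_cvg setT)) => //.
rewrite (_ : spatial_average _ w = cst 1); first exact: cvg_cst.
by apply/funext => n; rewrite indicT spatial_average_cst.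
Qed.

Lemma ultra_content_additive A B : A `&` B = set0 ->
  ultra_content (A `|` B) = ultra_content A + ultra_content B.
Proof.
move=> AB; apply: (cvg_unique _ (@ultra_content_cvg (A `|` B))) => //.
have -> : spatial_average \1_(A `|` B) w =
    spatial_average \1_A w \+ spatial_average \1_B w.
  apply/funext => n /=; rewrite -spatial_averageD; congr spatial_average.
  apply/funext => v; rewrite !indicE in_setU.
  have [/set_mem Av|_] := boolP (v \in A); last by rewrite add0r.
  have [/set_mem Bv|_] := boolP (v \in B); last by rewrite addr0.
  by have : set0 v by rewrite -AB.
by apply: cvgD; exact: ultra_content_cvg.
Qed.

Lemma ultra_content_tight (e : R) : 0 < e ->
  exists2 K : set Omega, compact K & ultra_content (~` K) <= e.
Proof.
move=> e0; have [K cK Ke] := spatial_average_tight w_tight e0; exists K => //.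
exact: (ultra_limit_mono (@ultra_content_cvg _) (@ultra_limit_cst e)).
Qed.

(** A staircase with steps of height [h <= e] approximates [f] from below. Its levels are indicators
    of closed superlevel sets, to which the hypothesis on [P] applies. *)
Lemma ultra_average_le_integral (P : probability Omega R) f M :
  (forall F, closed F -> (ultra_content F)%:E <= P F)%E ->
  continuous f -> 0 < M -> (forall v, `|f v| <= M) ->
  ultra_average f <= \int[P]_v f v.
Proof.
move=> PF cf M0 fM; have mf := continuous_measurable_Omega cf.
apply/ler_addgt0Pr => e e0.
(* The range of [f + M] has length [2 * M] and is cut into [N.+1] steps of height at most [e]. *)
have [N Ne] : exists N, 2 * M / e <= N.+1%:R.
  exists (Num.bound (2 * M / e)).
  rewrite (le_trans (ltW (archi_boundP _)))// ?ler_nat//.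
  by rewrite divr_ge0 ?mulr_ge0 ?ltW.
pose h : R := 2 * M / N.+1%:R.
have h0 : 0 < h by rewrite divr_gt0 ?mulr_gt0.
have he : h <= e by rewrite /h ler_pdivrMr// [leRHS]mulrC -ler_pdivrMr.
(* The large inequality makes the superlevel sets closed. *)
pose A k := [set v : Omega | k.+1%:R <= (f v + M) / h].
have AE k : A k = f @^-1` [set x | k.+1%:R * h - M <= x].
  by apply/seteqP; split=> v; rewrite /A/= ler_pdivlMr// lerBlDr.
have cA k : closed (A k).
  rewrite AE; apply: closed_comp; last exact: closed_ge.
  by move=> v _; exact: cf.
have mA k : measurable (A k).
  rewrite -[A k]setCK; apply: measurableC; apply: open_measurable_Omega.
  exact: closed_openC.
pose S v : R := \sum_(k < N.+1) \1_(A k) v.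
have SE v : S v = steps N.+1 ((f v + M) / h).
  apply: eq_bigr => k _; rewrite indicE; congr (nat_of_bool _)%:R.
  by apply/idP/idP => [/set_mem//|?]; exact: mem_set.
have fM' v : - M <= f v <= M by rewrite -ler_norml.
have Sle v : - M + h * S v <= f v.
  have s0 : 0 <= (f v + M) / h.
    by apply: divr_ge0; [have := fM' v; lra|exact: ltW].
  have := steps_le N.+1 s0; rewrite -SE ler_pdivlMr//; lra.
have leS v : f v <= - M + h + h * S v.
  have sN : (f v + M) / h <= N.+1%:R.
    rewrite ler_pdivrMr// /h [leRHS]mulrC divfK ?pnatr_eq0//.
    by have := fM' v; lra.
  have := le_steps sN; rewrite -SE ler_pdivrMr//; lra.
have L1 : ultra_average f <= - M + h + h * \sum_(k < N.+1) ultra_content (A k).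
  have c1 : (fun n => - M + h +
      h * \sum_(k < N.+1) spatial_average \1_(A k) w n) @ U -->
      - M + h + h * \sum_(k < N.+1) ultra_content (A k).
    apply: cvgD; first exact: cvg_cst.
    apply: cvgMr; apply: cvg_big => [|k _]; last exact: ultra_content_cvg.
    exact: add_continuous.
  apply: (ultra_limit_mono (ultra_average_cvg fM) c1) => n.
  rewrite -(spatial_average_sum w N.+1 (fun k => \1_(A k))).
  rewrite -(spatial_averageZ w h).
  rewrite -[X in X + _](spatial_average_cst w (- M + h) n).
  by rewrite -spatial_averageD; exact: spatial_average_le.
have L2 : \sum_(k < N.+1) ultra_content (A k) <= \int[P]_v S v.
  rewrite Rintegral_sum_indicator//; apply: ler_sum => k _.
  by rewrite -lee_fin fineK ?fin_num_measure// PF.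
have iS : P.-integrable setT (EFin \o S) by exact: sum_indicator_integrable.
have ihS : P.-integrable setT (EFin \o (fun v => h * S v)).
  exact: (integrableZl _ h iS).
have icst (c : R) : P.-integrable setT (EFin \o cst c).
  exact: (@bounded_integrable _ _ P _ `|c|).
have L3 : - M + h * \int[P]_v S v <= \int[P]_v f v.
  rewrite -RintegralZl// -[X in X + _](mulr1 (- M)).
  rewrite -[X in _ * X](_ : fine (P setT) = 1); last first.
    by have -> : P setT = 1%E := probability_setT P.
  rewrite -Rintegral_cst// -RintegralD//; last exact: icst.
  apply: le_Rintegral => //.
    exact: (integrableD _ (icst (- M)) ihS).
  exact: bounded_integrable fM.
have : h * \sum_(k < N.+1) ultra_content (A k) <= h * \int[P]_v S v.
  by rewrite ler_pM2l.
lra.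
Qed.

(** The inequality of [ultra_average_le_integral], applied to [f] and to its opposite, becomes an
    equality. *)
Lemma ultralimit_probability : exists P : probability Omega R,
  forall f, Cb f -> 'E_P[f]%E = (ultra_average f)%:E.
Proof.
have [mu [mu_open mu1 mu_closed]] := tight_content_outer_measure
  (@Omega_hausdorff R d) (@Omega_regular R d) ultra_content_ge0
  ultra_content_additive ultra_content_setT ultra_content_tight.
have mucara : measurable `<=` mu.-caratheodory.
  move=> A /measurable_sigma_boxes; apply: smallest_sub.
    exact: (@sigma_algebra_measurable _ (caratheodory_type mu)).
  by move=> _ [s _ <-]; apply: mu_open; exact: open_box_open.
have [P PE] := outer_measure_probability mucara mu1.
have PF F : closed F -> ((ultra_content F)%:E <= P F)%E.
  by move=> /mu_closed; rewrite PE.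
exists P => f [cf /bounded_funE[M M0 fM]].
have mf := continuous_measurable_Omega cf.
rewrite (expectation_Rintegral _ mf fM); congr EFin; apply/eqP.
rewrite eq_le (ultra_average_le_integral PF cf M0 fM) andbT.
have cNf : continuous (fun v => - f v) 
  by move=> v; exact: (@continuousN _ R^o Omega f v (cf v)).
have NfM v : `|- f v| <= M by rewrite normrN.
have := ultra_average_le_integral PF cNf M0 NfM.
have -> : ultra_average (fun v => - f v) = - ultra_average f.
  apply: (cvg_unique _ (ultra_average_cvg NfM)) => //.
  have -> : spatial_average (fun v => - f v) w = - spatial_average f w.
    apply/funext => n /=; rewrite -[RHS]mulN1r -spatial_averageZ.
    by congr spatial_average; apply/funext => v; rewrite mulN1r.
  by apply: cvgN; exact: ultra_average_cvg fM.
have -> : \int[P]_v - f v = - \int[P]_v f v.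
  under eq_Rintegral do rewrite -mulN1r.
  by rewrite RintegralZl ?mulN1r//; exact: bounded_integrable fM.
by rewrite lerN2.
Qed.

End ultralimit.

(** * The limit law *)

Section limit_law.
Context {R : realType} {d : nat} (w : Omega R d).
Hypotheses (w_avg : averaging w) (w_tight : tight w).
Local Notation Omega := (Omega R d).
Implicit Types P Q : probability Omega R.

(** Ultrafilters containing [\oo] are the free ones; a single law has to serve them all. *)
Definition is_limit_law P :=
  forall U : set_system nat, UltraFilter U -> \oo `<=` U ->
  forall f, Cb f -> 'E_P[f]%E = (ultra_average w U f)%:E.

(** The averaging hypothesis enters here: an actual limit is also the limit along every free
    ultrafilter. *)
Lemma ultra_average_Cloc (U : set_system nat) (f : Omega -> R) :
  UltraFilter U -> \oo `<=` U -> Cloc f -> ultra_average w U f = ell w f.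
Proof.
move=> UU ooU /w_avg/cvg_ex[l fl]; rewrite /ell (cvg_lim _ fl)//.
by apply: cvg_lim => //; apply: cvg_trans fl => A /ooU.
Qed.

Lemma same_law_expectation P Q f : same_law P Q -> 'E_P[f]%E = 'E_Q[f]%E.
Proof.
move=> PQ; rewrite expectation.unlock.
by apply: eq_measure_integral => A mA _; exact: PQ.
Qed.

(** The laws obtained from two free ultrafilters give the same mean [ell] to each bump of a positive
    box, hence coincide. *)
Lemma exists_limit_law : exists P, is_limit_law P.
Proof.
have [U [UU ooU]] := @ultraFilterLemma nat \oo _.
have [P PE] := ultralimit_probability UU w_tight; exists P => V VV ooV f fb.
have [Q QE] := ultralimit_probability VV w_tight.
rewrite -QE//; apply: same_law_expectation; apply: bumps_determine => s k ps.
rewrite (PE _ (bump_Cb _ _)) (QE _ (bump_Cb _ _)).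
by rewrite !ultra_average_Cloc//; exact: bump_Cloc.
Qed.

(** The limit is the same along all free ultrafilters, so [ultra_limit_le] upgrades it to an
    ordinary limit. *)
Lemma limit_law_cvg P (f : Omega -> R) : is_limit_law P -> Cb f ->
  spatial_average f w @ \oo --> fine 'E_P[f]%E.
Proof.
move=> PE fb A Al.
apply: (@ultra_limit_le nat \oo (spatial_average f w @^-1` A)) => U UU ooU.
have [_ /bounded_funE[M _ fM]] := fb.
have Uf := ultra_average_cvg (w := w) UU fM.
by apply: Uf; move: Al; rewrite (PE U).
Qed.

Lemma limit_law_ell P f : is_limit_law P -> Cb f -> 'E_P[f]%E = (ell w f)%:E.
Proof.
move=> PE fb; rewrite /ell (cvg_lim _ (limit_law_cvg PE fb))//.
have [U [UU ooU]] := @ultraFilterLemma nat \oo _.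
by rewrite (PE U).
Qed.

Lemma tau_measurable x : measurable_fun setT (@tau R d x).
Proof.
apply: (measurability (@coordinate_events R d)) => //.
move=> _ [_ [e _ [B mB <-]] <-]; rewrite !setTI.
apply: sub_sigma_algebra; exists (edge_shift x e) => //.
by exists B => //; rewrite setTI.
Qed.

Lemma Cb_tau x f : Cb f -> Cb (f \o @tau R d x).
Proof.
move=> [cf [M [Mr fM]]]; split.
  move=> v; apply: continuous_comp; [exact: tau_continuous|exact: cf].
by exists M; split=> // N MN v _; exact: fM.
Qed.

Lemma ell_tau x f : Cb f -> ell w (f \o tau x) = ell w f.
Proof.
move=> fb; have [P PE] := exists_limit_law.
have [_ /bounded_funE[M _ fM]] := fb.
have cf := limit_law_cvg PE fb; have cfx := limit_law_cvg PE (Cb_tau x fb).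
rewrite /ell (cvg_lim _ cf)// (cvg_lim _ cfx)//.
apply/eqP; rewrite -subr_eq0; apply/eqP.
apply: (@cvg_unique R _ (_ @ \oo)) (spatial_average_shift w x fM) => //.
exact: cvgB.
Qed.

End limit_law.
Local Open Scope ereal_scope.

Theorem proposition1p3 (R : realType) (d : nat) (hd : (1 <= d)%N)
    (w : Omega R d) (w_avg : averaging w) (w_tight : tight w) :
  (forall f : Omega R d -> R, Cb f -> cvgn (spatial_average f w)) /\
  exists P : probability (Omega R d) R,
    [/\ forall f : Omega R d -> R, Cb f -> 'E_P[f] = (ell w f)%:E,
        forall Q : probability (Omega R d) R,
          (forall f : Omega R d -> R, Cb f -> 'E_Q[f] = (ell w f)%:E) ->
          same_law Q P &
        forall x : 'rV[int]_d, same_law (pushforward P (tau x)) P].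
Proof.
have [P PE] := exists_limit_law w_avg w_tight.
have Pell f := @limit_law_ell _ _ w P f PE.
split=> [f fb|]; first exact: cvgP (limit_law_cvg PE fb).
have PQ Q : (forall f, Cb f -> 'E_Q[f] = (ell w f)%:E) -> same_law Q P.
  move=> QE; apply: bumps_determine => s k _.
  by rewrite QE ?Pell//; exact: bump_Cb.
exists P; split=> // x; pose T := mfun_Sub (mem_set (@tau_measurable R d x)).
(* Invariance is an instance of uniqueness: the image law also has means [ell], because [ell] is
   unchanged by composition with a shift. *)
suff PT : same_law (distribution P T) P by move=> A mA; rewrite -(PT A mA).
apply: PQ => f fb.
have [cf /bounded_funE[M _ fM]] := fb.
have mf := continuous_measurable_Omega cf.
rewrite -(ell_tau w_avg w_tight x fb) -Pell; last exact: Cb_tau.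
rewrite expectation.unlock integral_distribution//.
  exact/measurable_EFinP.
have [cfx _] := Cb_tau x fb.
apply: (@bounded_integrable _ _ P _ M) => //.
exact: continuous_measurable_Omega.
Qed.
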